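(* Let $m^*=m^*_\beta\ge1$ and $k^*=k^*_\beta>m^*_\beta$ be integer-valued functions of $\beta\in(0,1)$. Put $$\varrho_{1,\beta}=\frac1{1+|\log\beta|},\quad \varrho_{2,\beta}=\frac{\varrho_{1,\beta}}{1+|\log|\log\beta||},\quad \alpha_{1,\beta}=\beta+(1-\varrho_{1,\beta})^{m^*_\beta+1},\quad \alpha_{3,\beta}=\frac{\beta(1-\varrho_{2,\beta})^{k^*_\beta}}{1+\beta},$$ and assume that $$\lim_{\beta\to0}\frac{|\log\alpha_{1,\beta}|}{|\log\beta|}=1,\quad \lim_{\beta\to0}\big(|\log\alpha_{3,\beta}|+k^*_\beta\log(1-\varrho_{2,\beta})\big)=+\infty,\quad \lim_{\beta\to0}\frac{|\log\alpha_{3,\beta}|}{|\log\beta|}=1.$$ Let $T^*_\beta=\inf\{n\ge1:\sum_{k=1}^ne^{Z^{k-1}_n}\ge h^*_\beta\}$ with $h^*_\beta=\frac{1-\alpha_{3,\beta}}{\varrho_{2,\beta}\,\alpha_{3,\beta}}$. Then, for any $0<\beta<1$, $T^*_\beta\in\mathcal H^*(\beta,k^*,m^* )$. Assume in addition that for some $0<I<\infty$ $$\sum_{n=1}^\infty\sup_{k\ge0}\mathsf P_k\Big\{\Big|\frac1nZ^k_{k+n}-I\Big|>\varepsilon\Big\}<\infty\quad\text{for all }\varepsilon>0.$$ Then $$\lim_{\beta\to0}\frac{\inf_{\tau\in\mathcal H^*(\beta,k^*,m^* )}\mathcal R^*_\nu(\tau)}{\mathcal R^*_\nu(T^*_\beta)}=1\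 \text{ for all fixed }\nu\ge0,\qquad\lim_{\beta\to0}\frac{\inf_{\tau\in\mathcal H^*(\beta,k^*,m^* )}\max_{0\le\nu\le k^*_\beta}\mathcal R^*_\nu(\tau)}{\max_{0\le\nu\le k^*_\beta}\mathcal R^*_\nu(T^*_\beta)}=1,$$ and, as $\beta\to0$, $$\mathcal R^*_\nu(T^*_\beta)\sim\inf_{\tau\in\mathcal H^*(\beta,k^*,m^* )}\mathcal R^*_\nu(\tau)\sim\frac{|\log\beta|}I\ \text{ for any }\nu\ge0,$$ $$\sup_{0\le\nu\le k^*_\beta}\mathcal R^*_\nu(T^*_\beta)\sim\inf_{\tau\in\mathcal H^*(\beta,k^*,m^* )}\sup_{0\le\nu\le k^*_\beta}\mathcal R^*_\nu(\tau)\sim\frac{|\log\beta|}I.$$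
   Context: Model. $X_1,X_2,\dots$ are observed random variables, $\mathbf X^n=(X_1,\dots,X_n)$, $\mathcal F_n=\sigma(X_1,\dots,X_n)$. The change point is $\nu\in\{0,1,2,\dots\}\cup\{\infty\}$; $X_\nu$ is the last pre-change observation and $\nu=\infty$ means no change. $f_{0,n}(X_n|\mathbf X^{n-1})$ and $f_{1,n}(X_n|\mathbf X^{n-1})$, $n\ge1$, are the pre- and post-change conditional densities of $X_n$ given $\mathbf X^{n-1}$ with respect to a sigma-finite measure $\mu$ (for $n=1$, unconditional densities; $f_{1,n}$ may depend on the change point). Under $\mathsf P_\infty$ (expectation $\mathsf E_\infty$) the conditional density of $X_n$ given $\mathbf X^{n-1}$ is $f_{0,n}$ for all $n\ge1$; under $\mathsf P_k$ (expectation $\mathsf E_k$), $0\le k<\infty$, it is $f_{0,n}$ for $n\le k$ and $f_{1,n}$ for $n>k$. For $k\le n-1$ the log-likelihood ratio is $$Z^k_n=\sum_{j=k+1}^n\log\frac{f_{1,j}(X_j|\mathbf X^{j-1})}{f_{0,j}(X_j|\mathbf X^{j-1})},\qquad \frac{d\mathsf P_k|_{\mathcal F_n}}{d\mathsf P_\infty|_{\mathcal F_n}}=e^{Z^k_n}$$ (where $f_{1,j}$ is the post-change density corresponding to change point $k$). $\mathcal M$ is the set of stopping times $\tau$ with respect to $(\mathcal F_n)$ with values in $\{1,2,\dots\}\cup\{\infty\}$; $\inf\varnothing=+\infty$. Risk, for finite $\nu\ge0$: $\mathcal R^*_\nu(\tau)=\mathsf E_\nu(\tau-\nu\mid\tau>\nu)$.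 For $0<\beta<1$ and integers $m^*\ge1$, $k^*>m^*$, $$\mathcal H^*(\beta,k^*,m^* )=\Big\{\tau\in\mathcal M:\sup_{1\le k\le k^*-m^*}\mathsf P_\infty(\tau<k+m^*\mid\tau\ge k)\le\beta\Big\}.$$ $a_\beta\sim b_\beta$ means $a_\beta/b_\beta\to1$. *)

(* Defs.v *)
From HB Require Import structures.
From mathcomp Require Import all_boot all_order all_algebra.
From mathcomp Require Import all_classical all_reals all_analysis.

Set Implicit Arguments.
Unset Strict Implicit.
Unset Printing Implicit Defensive.

Import Order.TTheory GRing.Theory Num.Theory.
Import numFieldNormedType.Exports.

Local Open Scope classical_set_scope.
Local Open Scope ring_scope.

(* Observations are indexed from 1, as X_1, X_2, ...; X 0 is never used. *)

Definition hist (Omega E : Type) (X : nat -> Omega -> E) (n : nat) (w : Omega) :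
  n.-tuple E := [tuple X i.+1 w | i < n].

(* F_n = sigma(X_1, ..., X_n); F_0 is the trivial sigma-algebra *)
Definition filt (Omega : Type) dE (E : measurableType dE)
    (X : nat -> Omega -> E) (n : nat) : set (set Omega) :=
  g_sigma_preimage (fun i : 'I_n => X i.+1).

(* A family f such that f n y x stands for f_n(x | y), with y ranging over the
   possible values of X^{n-1}; for n = 1, y is the empty tuple. *)
Definition density_family (E : Type) (R : Type) :=
  forall n : nat, n.-1.-tuple E -> E -> R.

Section model.
Context {R : realType} {dO dE : measure_display}
  {Omega : measurableType dO} {E : measurableType dE}.
Implicit Types (mu : {sigma_finite_measure set E -> \bar R})
  (X : nat -> Omega -> E) (Q : probability Omega R).

(* The displayed equation says that
   Q(X_n \in B | F_{n-1}) = \int_B g(x | X^{n-1}) mu(dx)  Q-almost surely. *)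
Definition cond_density mu X Q (n : nat) (g : n.-1.-tuple E -> E -> R) : Prop :=
  [/\ measurable_fun [set: n.-1.-tuple E * E] (fun z => g z.1 z.2),
      forall y x, 0 <= g y x &
      forall A B, filt X n.-1 A -> measurable B ->
        Q (A `&` X n @^-1` B) =
        (\int[Q]_(w in A) \int[mu]_(x in B) (g (hist X n.-1 w) x)%:E)%E].

(* Z^k_n. It is extended real-valued: a vanishing post-change density gives the
   value -oo (so that e^{Z^k_n} = 0). The points where a pre-change density
   vanishes are negligible under every measure of the model below. *)
Definition llr X (f0 : density_family E R) (f1 : nat -> density_family E R)
    (k n : nat) (w : Omega) : \bar R :=
  (\sum_(k.+1 <= j < n.+1)
     lne ((f1 k j (hist X j.-1 w) (X j w))%:E
          / (f0 j (hist X j.-1 w) (X j w))%:E))%E.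

(* f1 k n is the post-change density of X_n for the change point k; Pinf and
   P k are the probabilities for the change points infinity and k. *)
Record changepoint_model mu X (f0 : density_family E R)
    (f1 : nat -> density_family E R) (Pinf : probability Omega R)
    (P : nat -> probability Omega R) : Prop := {
  model_meas : forall n, (1 <= n)%N -> measurable_fun setT (X n) ;
  model_inf : forall n, (1 <= n)%N -> cond_density mu X Pinf (f0 n) ;
  model_pre : forall k n, (1 <= n <= k)%N -> cond_density mu X (P k) (f0 n) ;
  model_post : forall k n, (k < n)%N -> cond_density mu X (P k) (f1 k n) ;
  (* e^{Z^k_n} is the density of P_k w.r.t. P_infty on F_n; in particular P_k is
     absolutely continuous w.r.t. P_infty on F_n *)
  model_lr : forall k n, (k < n)%N -> forall A, filt X n A ->
    P k A = (\int[Pinf]_(w in A) expeR (llr X f0 f1 k n w))%E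
}.

(* Random times are extended real-valued, with values in {1, 2, ...} U {+oo}. *)
Definition stopping_time X (tau : Omega -> \bar R) : Prop :=
  (forall w, tau w = +oo%E \/ exists2 n, (1 <= n)%N & tau w = n%:R%:E) /\
  (forall n, filt X n [set w | (tau w <= n%:R%:E)%E]).

(* Conditioning on an event B of positive probability; since 0 / 0 = 0 in
   \bar R, both quantities are 0 when B is negligible. *)
Definition cond_prob Q (A B : set Omega) : \bar R := (Q (A `&` B) / Q B)%E.

Definition cond_expect Q (g : Omega -> \bar R) (B : set Omega) : \bar R :=
  ((\int[Q]_(w in B) g w) / Q B)%E.

Definition risk (P : nat -> probability Omega R) (nu : nat)
    (tau : Omega -> \bar R) : \bar R :=
  cond_expect (P nu) (fun w => (tau w - nu%:R%:E)%E)
    [set w | (nu%:R%:E < tau w)%E].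

Definition Hstar X (Pinf : probability Omega R) (beta : R) (ks ms : nat) :
    set (Omega -> \bar R) :=
  [set tau | stopping_time X tau /\
    (ereal_sup [set cond_prob Pinf [set w | tau w < (k + ms)%:R%:E]
                                   [set w | k%:R%:E <= tau w]
               | k in [set k | (1 <= k <= ks - ms)%N]] <= beta%:E)%E].

Definition SR_stat X (f0 : density_family E R) (f1 : nat -> density_family E R)
    (n : nat) (w : Omega) : \bar R :=
  (\sum_(1 <= k < n.+1) expeR (llr X f0 f1 k.-1 n w))%E.

(* ereal_inf of the empty set is +oo *)
Definition SR_time X (f0 : density_family E R) (f1 : nat -> density_family E R)
    (h : R) (w : Omega) : \bar R :=
  ereal_inf [set n%:R%:E | n in
    [set n | (1 <= n)%N /\ (h%:E <= SR_stat X f0 f1 n w)%E]].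

End model.

Section parameters.
Context {R : realType}.
Implicit Types beta : R.

Definition rho1 beta : R := (1 + `|ln beta|)^-1.
Definition rho2 beta : R := rho1 beta / (1 + `|ln `|ln beta| |).
Definition alpha1 (ms : R -> nat) beta : R :=
  beta + (1 - rho1 beta) ^+ (ms beta).+1.
Definition alpha3 (ks : R -> nat) beta : R :=
  beta * (1 - rho2 beta) ^+ (ks beta) / (1 + beta).
Definition hstar (ks : R -> nat) beta : R :=
  (1 - alpha3 ks beta) / (rho2 beta * alpha3 ks beta).

(* a_beta ~ b_beta as beta -> 0, beta > 0; the quotient is the one of \bar R, so
   for nonnegative a and b this forces them to be eventually finite and
   positive *)
Definition asymp_eq (a b : R -> \bar R) : Prop :=
  (a beta / b beta)%E @[beta --> 0^'+] --> 1%E.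

End parameters.

(* Main.v *)
Require Import Defs.
From HB Require Import structures.
From mathcomp Require Import all_boot all_order all_algebra.
From mathcomp Require Import all_classical all_reals all_analysis.
From mathcomp Require Import measurable_realfun ring lra.

Set Implicit Arguments.
Unset Strict Implicit.
Unset Printing Implicit Defensive.

Import Order.TTheory GRing.Theory Num.Theory.
Import numFieldNormedType.Exports.

Local Open Scope classical_set_scope.
Local Open Scope ring_scope.

(** Write l = |ln beta|, h = hstar, and ks, ms for their values at beta. Both
the risk of T and the smallest risk over the class are shown to lie between
(1 - e) l / I and (1 + e) l / I for every e and all small beta
([SR_risk_within_factor], [inf_risk_within_factor]), and likewise for the worst
risk over the change points up to ks. All ratios in the theorem then tend to 1
([within_factor_ratio]).

Membership of T in the class. Summing, over n <= N, the integrals of SR_n over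
the events T = n, where SR_n >= h, and using that e^{Z^k_n} is the density of
P_k, gives h Pinf(T <= N) <= \sum_(k < N) P_k(T <= N) <= N
([SR_time_prob]). The threshold satisfies ks (1 + beta) <= beta h, because
(1 - rho)^k (1 + k rho) <= 1 ([hstar_gt0_ge]); so T exceeds ks with
Pinf-probability at least 1 / (1 + beta), and dividing two such bounds gives
the conditional probability bound beta ([SR_time_Hstar]).

Upper bound. Since SR_n >= e^{Z^nu_n}, on T > nu + j the log-likelihood ratio
Z^nu_(nu + j) is below ln h, which for j >= N ~ ln h / (I - eps) is a deviation
of Z / j from I by more than eps. Such probabilities are summable uniformly in
nu, and the expected delay is the sum over j of P_nu(T > nu + j), hence at most
N + O(1). Conditioning on T > nu costs a factor at most 1 + beta, as P_nu and
Pinf agree on F_nu ([pre_change_eq], [SR_risk_le]). Finally ln h <= (1 + e) l,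
since |ln alpha3| ~ l and |ln rho2| = o(l) ([near_ln_hstar]).

Lower bound. For tau in the class, Pinf(tau <= ms) <= beta, and the hypothesis
on alpha1 makes ms of order at least l^2, hence larger than nu + N with
N = (1 - e) l / I ([near_ms_ge]). Changing measure on the event tau <= nu + N,
P_nu(tau <= nu + N) is at most exp ((1 + e) I N) beta <= exp (- e^2 l) plus the
probability that Z^nu_(nu + N) exceeds (1 + e) I N; both tend to 0, so the
delay is at least N with probability close to 1 ([Hstar_risk_ge]). *)

(** * Exponential and logarithm on the extended reals *)

Section extended_real_functions.
Context {R : realType}.

Lemma measurable_expeR : measurable_fun setT (@expeR R).
Proof.
rewrite (_ : expeR = fun x => if x == -oo%E then 0%E else er_map (@expR R) x).
  apply: measurable_fun_ifT => //; first exact: measurable_fun_eqe.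
  by apply: (@measurable_er_map _ (measurableTypeR R)); exact: measurable_expR.
by apply/funext; case.
Qed.

(** A ratio with zero denominator is 0 or +oo, so the zeros of both densities
are split off before the logarithm of the quotient becomes a difference. *)
Lemma measurable_lne_ratio d (T : measurableType d) (a b : T -> R) :
  measurable_fun setT a -> measurable_fun setT b ->
  (forall t, 0 <= a t) -> (forall t, 0 <= b t) ->
  measurable_fun setT (fun t => lne ((a t)%:E / (b t)%:E)%E).
Proof.
move=> ma mb a0 b0.
rewrite (_ : (fun t => _) = fun t => if a t == 0 then -oo%E else
    if b t == 0 then +oo%E else (ln (a t) - ln (b t))%:E); last first.
  apply/funext => t; have [at0|at0] := eqVneq (a t) 0.
    by rewrite at0 mul0e /= lexx.
  have {at0}at0 : 0 < a t by rewrite lt_neqAle eq_sym at0 a0.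
  rewrite inver; have [_|bt0] := eqVneq (b t) 0.
    by rewrite gt0_muley ?lte_fin.
  have {bt0}bt0 : 0 < b t by rewrite lt_neqAle eq_sym bt0 b0.
  by rewrite -EFinM lne_EFin ?divr_gt0 // ln_div.
apply: measurable_fun_ifT => //; first exact: measurable_fun_eqr.
apply: measurable_fun_ifT => //; first exact: measurable_fun_eqr.
apply/measurable_EFinP/measurable_funB.
  by apply: (measurableT_comp _ ma); exact: measurable_ln.
by apply: (measurableT_comp _ mb); exact: measurable_ln.
Qed.

End extended_real_functions.

(** * The filtration of the observations *)

Section filtration.
Context {R : realType} {dO dE : measure_display}
  {Omega : measurableType dO} {E : measurableType dE}.
Variable X : nat -> Omega -> E.

(** Omega with the sigma-algebra F_n: measurability with respect to F_n becomes
measurability of functions out of this type. *)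
Definition filtType n := g_sigma_algebraType
  (\big[setU/set0]_(i < n) preimage_set_system setT (X i.+1) measurable).

Lemma filt_measurable n : measurable = filt X n :> set (set (filtType n)).
Proof. by []. Qed.

(** F_n is generated by the single tuple-valued map X^n, so every event of F_n
is an event about the tuple; this turns integrals over such events into
integrals on the tuple space. *)
Lemma filt_hist n :
  filt X n = preimage_set_system [set: Omega] (hist X n) measurable.
Proof.
rewrite /filt /measurable /= -g_sigma_preimage_comp; congr g_sigma_preimage.
by apply/funext => i; apply/funext => w /=; rewrite tnth_mktuple.
Qed.

Lemma filt_measurable_X n j : (0 < j <= n)%N ->
  measurable_fun setT (X j : filtType n -> E).
Proof.
case: j => // j /= jn _ B mB; rewrite setTI filt_measurable.
rewrite filt_hist; exists ((@tnth _ E)^~ (Ordinal jn) @^-1` B).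
  by rewrite -[X in measurable X]setTI; exact: measurable_tnth.
by rewrite setTI; apply/seteqP; split => w /=; rewrite tnth_mktuple.
Qed.

Lemma filt_measurable_hist n j : (j <= n)%N ->
  measurable_fun setT (hist X j : filtType n -> j.-tuple E).
Proof.
move=> jn; apply/measurable_fun_tnthP => i.
rewrite (_ : _ \o _ = X i.+1); last first.
  by apply/funext => w /=; rewrite tnth_mktuple.
by apply: filt_measurable_X => /=; exact: leq_trans jn.
Qed.

Lemma filt_mono m n : (m <= n)%N -> filt X m `<=` filt X n.
Proof.
move=> mn A; rewrite filt_hist => -[C mC <-].
exact: (filt_measurable_hist mn).
Qed.

Hypothesis mX : forall n, (1 <= n)%N -> measurable_fun setT (X n).

Lemma measurable_hist n : measurable_fun setT (hist X n).
Proof.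
apply/measurable_fun_tnthP => i.
rewrite (_ : _ \o _ = X i.+1); first exact: mX.
by apply/funext => w /=; rewrite tnth_mktuple.
Qed.

Lemma filt_sub n : filt X n `<=` measurable.
Proof.
by move=> A; rewrite filt_hist => -[C mC <-]; exact: measurable_hist.
Qed.

Lemma filt_measurable_fun n d (T : measurableType d) (f : Omega -> T) :
  measurable_fun setT (f : filtType n -> T) -> measurable_fun setT f.
Proof. by move=> mf _ B mB; apply: filt_sub; exact: mf. Qed.

End filtration.

(** * Measurability and the agreement of the laws before the change *)

Section changepoint.
Context {R : realType} {dO dE : measure_display}
  {Omega : measurableType dO} {E : measurableType dE}.
Variables (mu : {sigma_finite_measure set E -> \bar R}) (X : nat -> Omega -> E)
  (f0 : density_family E R) (f1 : nat -> density_family E R)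
  (Pinf : probability Omega R) (P : nat -> probability Omega R).
Hypothesis model : changepoint_model mu X f0 f1 Pinf P.

Local Notation llr := (llr X f0 f1).
Local Notation SR_stat := (SR_stat X f0 f1).
Local Notation SR_time := (SR_time X f0 f1).
Local Notation filt_sub := (filt_sub (model_meas model)).

Lemma filt_measurable_density n j (g : j.-1.-tuple E -> E -> R) :
  (0 < j <= n)%N -> measurable_fun setT (fun z => g z.1 z.2) ->
  measurable_fun setT
    ((fun w => g (hist X j.-1 w) (X j w)) : filtType X n -> R).
Proof.
move=> /andP[j0 jn] mg.
apply: (measurableT_comp (f := fun z => g z.1 z.2) mg
  (g := fun w : filtType X n => (hist X j.-1 w, X j w))).
apply: measurable_fun_pair; last by apply: filt_measurable_X; rewrite j0.
by apply: filt_measurable_hist; rewrite (leq_trans (leq_pred _)).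
Qed.

(** For k < j <= n the j-th ratio is a measurable function of X^(j-1) and X_j,
both F_n-measurable; the indices outside this range contribute nothing. *)
Lemma filt_measurable_llr k n :
  measurable_fun setT (llr k n : filtType X n -> \bar R).
Proof.
rewrite (_ : llr k n = fun w =>
    (\sum_(j <- index_iota k.+1 n.+1) if (k < j < n.+1)%N && true then
      lne ((@f1 k j (hist X j.-1 w) (X j w))%:E
           / (@f0 j (hist X j.-1 w) (X j w))%:E) else 0)%E);
  last by apply/funext => w; rewrite /Defs.llr big_nat_cond big_mkcond.
apply: emeasurable_sum => j.
case kjn: (k < j < n.+1)%N => /=; last exact: measurable_cst.
move: kjn; rewrite ltnS => /andP[kj jn].
have j0 : (0 < j)%N by exact: leq_trans kj.
have [m0 g0 _] := model_inf model j0.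
have [m1 g1 _] := model_post model kj.
by apply: measurable_lne_ratio => //;
  apply: filt_measurable_density; rewrite ?j0.
Qed.

Lemma measurable_llr k n : measurable_fun setT (llr k n).
Proof.
exact: (filt_measurable_fun (model_meas model) (@filt_measurable_llr k n)).
Qed.

Lemma filt_measurable_SR_stat n :
  measurable_fun setT (SR_stat n : filtType X n -> \bar R).
Proof.
apply: emeasurable_sum => k.
exact: (measurableT_comp measurable_expeR (@filt_measurable_llr k.-1 n)).
Qed.

(** By transport to the tuple space, where both integrals are taken with respect
to laws of X^m that coincide. *)
Lemma integral_hist_eq (Q1 Q2 : probability Omega R) m
    (g : m.-tuple E -> \bar R) A :
  (forall B, filt X m B -> Q1 B = Q2 B) ->
  measurable_fun setT g -> (forall y, 0 <= g y)%E -> filt X m A ->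
  (\int[Q1]_(w in A) g (hist X m w) = \int[Q2]_(w in A) g (hist X m w))%E.
Proof.
move=> Q12 mg g0; rewrite filt_hist => -[C mC <-].
have mh : measurable_fun setT (hist X m).
  by apply: measurable_hist; exact: (model_meas model).
rewrite setTI -!(ge0_integral_pushforward mh) //; last 2 first.
  exact: measurable_funS mg.
  exact: measurable_funS mg.
apply: eq_measure_integral => B mB BC.
rewrite /pushforward; apply: Q12; rewrite filt_hist.
by exists B; rewrite ?setTI.
Qed.

Lemma measurable_partial_integral m (B : set E) (g : m.-tuple E -> E -> R) :
  measurable B -> measurable_fun setT (fun z => g z.1 z.2) ->
  (forall y x, 0 <= g y x) ->
  measurable_fun setT (fun y => \int[mu]_(x in B) (g y x)%:E)%E.
Proof.
move=> mB mg g0.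
rewrite (_ : (fun y => _) =
    fubini_F mu (fun z => (g z.1 z.2 * \1_B z.2)%:E)); last first.
  by apply/funext => y; rewrite integral_mkcond epatch_indic.
apply: measurable_fun_fubini_tonelli_F; last first.
  by move=> z; rewrite lee_fin mulr_ge0.
apply/measurable_EFinP/measurable_funM => //.
by apply: (measurableT_comp (f := \1_B : E -> R)).
Qed.

(** Up to time k both laws have the conditional densities f_(0,n), so by
induction they agree on the events A /\ (X_n in B) with A in F_(n-1). These are
stable under intersection and generate F_n. *)
Lemma pre_change_eq k n A : (n <= k)%N -> filt X n A -> P k A = Pinf A.
Proof.
elim: n A => [|n IHn] A nk.
  rewrite /filt /g_sigma_preimage big_ord0 => FA.
  apply: (@g_sigma_algebra_measure_unique _ _ _ [set setT] _ (fun=> setT)).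
  - by move=> _ ->.
  - by [].
  - by rewrite bigcup_const.
  - by move=> _ _ -> ->; rewrite setTI.
  - by move=> _ ->; rewrite /= !probability_setT.
  - by move=> _ /=; rewrite probability_setT ltry.
  - exact: sub_sigma_algebra2 FA.
pose G := [set A `&` X n.+1 @^-1` B | A in filt X n & B in @measurable _ E].
move=> FA.
apply: (@g_sigma_algebra_measure_unique _ _ _ G _ (fun=> setT)).
- move=> _ [C FC [B mB <-]]; apply: measurableI; first exact: filt_sub FC.
  by rewrite -[X in measurable X]setTI; exact: (model_meas model).
- move=> _; exists setT; last by exists setT; rewrite ?setTI.
  by rewrite -filt_measurable.
- by rewrite bigcup_const.
- move=> _ _ [C FC [B mB <-]] [C' FC' [B' mB' <-]].
  exists (C `&` C'); first by rewrite -filt_measurable; exact: measurableI.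
  by exists (B `&` B'); [exact: measurableI|rewrite preimage_setI setIACA].
- move=> _ [C FC [B mB <-]].
  have nk1 : (1 <= n.+1 <= k)%N by [].
  have [mf f0_ge0 Pk] := model_pre model nk1.
  have [_ _ Pi] := model_inf model (ltn0Sn n).
  rewrite /= Pk // Pi //.
  apply: (@integral_hist_eq (P k) Pinf n
    (fun y => \int[mu]_(x in B) (@f0 n.+1 y x)%:E)%E) => //.
  + by move=> D FD; exact: (IHn _ (ltnW nk)).
  + exact: measurable_partial_integral.
  + by move=> y; apply: integral_ge0 => x _; rewrite lee_fin.
- by move=> _ /=; rewrite probability_setT ltry.
- move: FA; rewrite /filt /g_sigma_preimage.
  apply: smallest_sub; first exact: smallest_sigma_algebra.
  rewrite -bigcup_mkord_ord => D [i /= i_lt [B mB <-]].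
  apply: sub_sigma_algebra; rewrite setTI inordK //.
  have [->|i_neq] := eqVneq i n.
    exists setT; first by rewrite -filt_measurable.
    by exists B; rewrite ?setTI.
  have i_ltn : (0 < i.+1 <= n)%N.
    by move: i_lt; rewrite ltnS leq_eqVlt (negPf i_neq).
  exists (X i.+1 @^-1` B); last first.
    by exists setT => //; rewrite preimage_setT setIT.
  rewrite -filt_measurable -[X in measurable X]setTI.
  exact: filt_measurable_X.
Qed.

(** * The Shiryaev-Roberts time and its false alarms *)

Lemma ereal_inf_natP (S : set nat) :
  let m : \bar R := ereal_inf [set n%:R%:E | n in S] in
  (m = +oo%E /\ S = set0) \/
  (exists2 n, S n & m = n%:R%:E /\ forall i, S i -> (n <= i)%N).
Proof.
move=> m; have [S0|/set0P Sne] := eqVneq S set0.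
  by left; split=> //; rewrite /m S0 image_set0 ereal_inf0.
right; have [i Si] := Sne.
have Sex : exists n, (n \in S) by exists i; rewrite inE.
have [n /set_mem Sn nmin] := ex_minnP Sex.
have {}nmin j : S j -> (n <= j)%N by move=> Sj; apply: nmin; rewrite inE.
exists n => //; split=> //; apply/eqP; rewrite eq_le; apply/andP; split.
  by apply: ereal_inf_lbound; exists n.
by apply: le_ereal_inf_tmp => _ [j Sj <-]; rewrite lee_fin ler_nat; exact: nmin.
Qed.

Lemma SR_time_leP (h : R) n w :
  (SR_time h w <= n%:R%:E)%E <->
  exists2 m, (1 <= m <= n)%N & (h%:E <= SR_stat m w)%E.
Proof.
rewrite /Defs.SR_time.
have [[-> S0]|[m [m1 hm] [-> mmin]]] := ereal_inf_natP
  [set n | (1 <= n)%N /\ (h%:E <= SR_stat n w)%E].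
  split=> [|[m /andP[m1 _] hm]]; first by rewrite leNgt ltry.
  by have : set0 m by rewrite -S0.
split=> [|[i /andP[i1 ni] hi]]; rewrite lee_fin ler_nat.
  by move=> mn; exists m; rewrite ?m1.
by rewrite (leq_trans _ ni) // mmin.
Qed.

Lemma SR_time_stopping h : stopping_time X (SR_time h).
Proof.
split=> [w|n].
  rewrite /Defs.SR_time.
  have [[-> _]|[m [m1 _] [-> _]]] := ereal_inf_natP
    [set n | (1 <= n)%N /\ (h%:E <= SR_stat n w)%E].
    by left.
  by right; exists m.
pose C i := [set w | (h%:E <= SR_stat i.+1 w)%E].
rewrite (_ : [set w | _] = \big[setU/set0]_(i < n) C i); last first.
  apply/seteqP; split=> [w /SR_time_leP[[//|m] /= mn hm]|w].
    by rewrite -(bigcup_mkord n C); exists m.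
  by rewrite -(bigcup_mkord n C) => -[m mn hm]; apply/SR_time_leP; exists m.+1.
rewrite -filt_measurable; apply: bigsetU_measurable => i _; rewrite /C.
rewrite filt_measurable; apply: (@filt_mono _ _ _ _ X i.+1) => //.
rewrite -filt_measurable -[X in measurable X]setTI.
exact: (emeasurable_fun_c_infty measurableT (@filt_measurable_SR_stat i.+1)).
Qed.

Lemma SR_integral n A : filt X n A ->
  (\int[Pinf]_(w in A) SR_stat n w = \sum_(k < n) P k A)%E.
Proof.
move=> FA; rewrite /Defs.SR_stat.
under eq_integral do rewrite big_add1 /= big_mkord.
rewrite ge0_integral_sum //; first last.
- by move=> k w _; exact: expeR_ge0.
- move=> k; apply: measurable_funTS.
  exact: (measurableT_comp measurable_expeR (@measurable_llr k n)).
- exact: filt_sub FA.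
by apply: eq_bigr => k _; rewrite (model_lr model (ltn_ord k) FA).
Qed.

Lemma stopping_le_measurable (tau : Omega -> \bar R) n : stopping_time X tau ->
  measurable [set w | (tau w <= n%:R%:E)%E].
Proof. by case=> _ /(_ n); exact: filt_sub. Qed.

Lemma stopping_gt_measurable (tau : Omega -> \bar R) n : stopping_time X tau ->
  measurable [set w | (n%:R%:E < tau w)%E].
Proof.
move=> st; rewrite (_ : [set w | _] = ~` [set w | (tau w <= n%:R%:E)%E]).
  exact/measurableC/stopping_le_measurable.
by apply/seteqP; split => w /=; rewrite ltNge => /negP.
Qed.

Lemma stopping_ltS (tau : Omega -> \bar R) n w : stopping_time X tau ->
  (tau w < n.+1%:R%:E)%E = (tau w <= n%:R%:E)%E.
Proof.
move=> -[/(_ w)[->|[m _ ->]] _]; first by rewrite !leNgt !ltry /= ltNge leey.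
by rewrite lte_fin lee_fin ltr_nat ler_nat.
Qed.

(** At the first crossing SR_n >= h, and SR_n is the sum of the densities of
P_0, ..., P_(n-1) on F_n, so h Pinf(T = n) is at most the sum over k < n of
P_k(T = n). The induction adds these bounds up: passing from n to n + 1 also
puts the nonnegative term P_n(T <= n) on the right. *)
Lemma SR_time_crossing_prob (h : R) n : 0 <= h ->
  (h%:E * Pinf [set w | SR_time h w <= n%:R%:E] <=
   \sum_(k < n) P k [set w | SR_time h w <= n%:R%:E])%E.
Proof.
move=> h0; have st := SR_time_stopping h.
pose A n := [set w | (SR_time h w <= n%:R%:E)%E].
pose D n := A n.+1 `\` A n.
have mA m : measurable (A m) by exact: stopping_le_measurable.
have mD m : measurable (D m) by exact: measurableD.
have AD m (Q : probability Omega R) : (Q (A m.+1) = Q (A m) + Q (D m))%E.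
  rewrite -measureU //; last by rewrite /D setDIK.
  rewrite /D setDUK // => w /= /le_trans; apply.
  by rewrite lee_fin ler_nat.
rewrite -/(A n); elim: n => [|n IHn].
  rewrite big_ord0 (_ : A 0%N = set0) ?measure0 ?mule0 //.
  by apply/seteqP; split=> // w /SR_time_leP[[]].
rewrite AD ge0_muleDr // big_ord_recr /=.
under eq_bigr do rewrite AD.
rewrite big_split /= AD -addeA leeD //.
apply: (@le_trans _ _ (\sum_(k < n.+1) P k (D n))%E); last first.
  by rewrite big_ord_recr /= leeD2l // leeDr.
rewrite -SR_integral; last first.
  rewrite -filt_measurable; apply: measurableD; rewrite filt_measurable.
    by case: st.
  by apply: (filt_mono (leqnSn n)); case: st.
rewrite -integral_cst //; apply: ge0_le_integral => //.
- apply: measurable_funTS; apply: (filt_measurable_fun (model_meas model)).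
  exact: filt_measurable_SR_stat.
move=> w [/SR_time_leP[m /andP[m1]]]; rewrite leq_eqVlt => /predU1P[-> //|].
by rewrite ltnS => mn hm /SR_time_leP[]; exists m; rewrite ?m1.
Qed.

Lemma SR_time_prob (h : R) n : 0 < h ->
  (Pinf [set w | SR_time h w <= n%:R%:E] <= (n%:R / h)%:E)%E.
Proof.
move=> h0; rewrite mulrC EFinM lee_pdivlMl //.
apply: le_trans (SR_time_crossing_prob _ (ltW h0)) _.
rewrite [leRHS](_ : _ = \sum_(k < n) 1%E); last first.
  by rewrite sumEFin sumr_const card_ord.
apply: lee_sum => k _; apply: probability_le1.
exact: (stopping_le_measurable n (SR_time_stopping h)).
Qed.

Lemma probability_finE (Q : probability Omega R) A : measurable A ->
  exists2 p : R, 0 <= p <= 1 & Q A = p%:E.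
Proof.
move=> mA; have fin := fin_num_measure Q A mA.
exists (fine (Q A)); last by rewrite fineK.
by rewrite -!lee_fin fineK // measure_ge0 probability_le1.
Qed.

Lemma stopping_gt_prob (Q : probability Omega R) (tau : Omega -> \bar R) n :
  stopping_time X tau ->
  Q [set w | (n%:R%:E < tau w)%E] = (1 - Q [set w | (tau w <= n%:R%:E)%E])%E.
Proof.
move=> st; rewrite -probability_setC; last exact: stopping_le_measurable.
by congr (Q _); apply/seteqP; split => w /=; rewrite ltNge => /negP.
Qed.

(** The product bound on h says that ks / h <= beta / (1 + beta). *)
Lemma SR_time_gt_Pinf (beta h : R) ks n : 0 < beta < 1 -> 0 < h ->
  ks%:R * (1 + beta) <= beta * h -> (n <= ks)%N ->
  ((1 + beta)^-1%:E <= Pinf [set w | (n%:R%:E < SR_time h w)%E])%E.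
Proof.
move=> /andP[b0 b1] h0 hks nks.
have st := SR_time_stopping h.
rewrite stopping_gt_prob //.
have := @SR_time_prob h n h0.
have [p /andP[p0 p1] ->] := probability_finE Pinf (stopping_le_measurable n st).
rewrite lee_fin => pn; rewrite -EFinB lee_fin.
have b10 : 0 < 1 + beta by rewrite addr_gt0.
rewrite lerBrDr -lerBrDl (le_trans pn) // ler_pdivrMr //.
rewrite -(ler_pM2r b10) [in leRHS]mulrAC mulrBl mul1r mulVf ?gt_eqF //.
rewrite addrAC subrr add0r; apply: le_trans hks.
by rewrite ler_pM2r // ler_nat.
Qed.

(** With k + ms <= ks, the numerator of the conditional probability is at most
ks / h <= beta / (1 + beta), and its denominator is at least 1 / (1 + beta). *)
Lemma SR_time_Hstar (beta h : R) ks ms : 0 < beta < 1 -> 0 < h ->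
  ks%:R * (1 + beta) <= beta * h -> Hstar X Pinf beta ks ms (SR_time h).
Proof.
move=> b01 h0 hks; have /andP[b0 b1] := b01.
have st := SR_time_stopping h.
split=> //; apply: ge_ereal_sup => _ [k /andP[k1 kle] <-].
have kms : (k + ms <= ks)%N.
  have [msks|msks] := leqP ms ks; first by rewrite addnC -leq_subRL // addnC.
  by move: kle; rewrite (eqP (ltnW msks)) leqNgt k1.
(* Times are integers, so k + 1 <= T means k < T. *)
case: k => // k in k1 kle kms *; rewrite /cond_prob.
rewrite (_ : [set w | (k.+1%:R%:E <= _)%E] =
    [set w | (k%:R%:E < SR_time h w)%E]); last first.
  by apply/seteqP; split => w /=; rewrite leNgt (stopping_ltS _ _ st) -ltNge.
have mgt := stopping_gt_measurable k st.
rewrite addSn (_ : [set w | (_ < (k + ms).+1%:R%:E)%E] =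
    [set w | (SR_time h w <= (k + ms)%:R%:E)%E]); last first.
  by apply/seteqP; split => w /=; rewrite (stopping_ltS _ _ st).
have mle := stopping_le_measurable (k + ms) st.
have := @SR_time_prob h (k + ms) h0.
have : (Pinf ([set w | (SR_time h w <= (k + ms)%:R%:E)%E] `&`
    [set w | (k%:R%:E < SR_time h w)%E]) <=
    Pinf [set w | (SR_time h w <= (k + ms)%:R%:E)%E])%E.
  by rewrite le_measure // ?inE //; exact: measurableI.
have := SR_time_gt_Pinf b01 h0 hks (leq_trans (leqW (leq_addr ms k)) kms).
have [p _ ->] := probability_finE Pinf mgt.
have [q _ ->] := probability_finE Pinf (measurableI _ _ mle mgt).
have [r _ ->] := probability_finE Pinf mle.
rewrite !lee_fin => pge qr rle.
have b10 : 0 < 1 + beta by rewrite addr_gt0.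
have p0 : 0 < p by apply: lt_le_trans pge; rewrite invr_gt0.
rewrite inver gt_eqF // -EFinM lee_fin ler_pdivrMr //.
apply: (le_trans qr); apply: (le_trans rle).
rewrite ler_pdivrMr //.
apply: (@le_trans _ _ (ks%:R)); first by rewrite ler_nat ltnW.
rewrite -[leLHS](mulfK (lt0r_neq0 b10)) [leRHS]mulrAC.
by apply: ler_pM => //; rewrite ?mulr_ge0 ?invr_ge0 // ltW.
Qed.

(** * Expected delay and bounds on the risk *)

Lemma stopping_tail_sum (tau : Omega -> \bar R) nu w : stopping_time X tau ->
  (nu%:R%:E < tau w)%E ->
  (tau w - nu%:R%:E)%E = (\sum_(0 <= j <oo)
     (\1_[set w | ((nu + j)%:R%:E < tau w)%E] w)%:E)%E.
Proof.
move=> [/(_ w)[|[n n1]] tw _] nut.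
  rewrite tw addye //; apply/esym/eqyP => A _ /=.
  apply: (@le_trans _ _ (\sum_(0 <= j < (Num.truncn A).+1) 1%:E)%E).
    rewrite sumEFin big_mkord sumr_const card_ord lee_fin.
    exact/ltW/truncnS_gt.
  apply: le_trans (nneseries_lim_ge (Num.truncn A).+1 _).
    by apply: lee_sum => j _; rewrite indicE mem_set //= tw ltry.
  by move=> j _ _; rewrite lee_fin.
move: nut; rewrite tw lte_fin ltr_nat => nun.
rewrite (nneseries_split 0 (n - nu)); last by move=> j _; rewrite lee_fin.
rewrite [X in _ = (_ + X)%E]eseries0 ?adde0; last first.
  move=> j /=; rewrite add0n leq_subLR => nj _; rewrite indicE memNset //=.
  by rewrite tw lte_fin ltr_nat ltnNge nj.
rewrite add0n (eq_big_nat _ _ (F2 := fun=> 1%:E)); last first.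
  move=> j jn; rewrite indicE mem_set //= tw lte_fin ltr_nat.
  by rewrite -ltn_subRL.
by rewrite sumEFin big_mkord sumr_const card_ord -EFinB natrB // ltnW.
Qed.

(** The tail-sum formula for the expectation of an integer-valued variable; both
sides may be +oo. *)
Lemma delay_integral (Q : probability Omega R) (tau : Omega -> \bar R) nu :
  stopping_time X tau ->
  (\int[Q]_(w in [set w | (nu%:R%:E < tau w)%E]) (tau w - nu%:R%:E) =
   \sum_(0 <= j <oo) Q [set w | ((nu + j)%:R%:E < tau w)%E])%E.
Proof.
move=> st; have mD n := stopping_gt_measurable n st.
under eq_integral => w /set_mem wD do rewrite (stopping_tail_sum st wD).
rewrite integral_nneseries //.
- apply: eq_eseriesr => j _; rewrite integral_indic //; congr (Q _).
  apply/setIidl => w /=; apply: le_lt_trans.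
  by rewrite lee_fin ler_nat leq_addr.
- by move=> j; apply/measurable_EFinP/measurable_indic.
Qed.

Definition llr_deviation (I eps : R) k n : set Omega :=
  [set w | (eps%:E < `| (n%:R^-1)%:E * llr k (k + n) w - I%:E |)%E].

Definition sup_deviation (I eps : R) n : \bar R :=
  ereal_sup [set P k (llr_deviation I eps k n) | k in [set: nat]].

Lemma llr_deviation_measurable I eps k n : measurable (llr_deviation I eps k n).
Proof.
have mf : measurable_fun setT
    (fun w => `| (n%:R^-1)%:E * llr k (k + n) w - I%:E |)%E.
  apply: measurableT_comp => //.
  apply: emeasurable_funB => //; apply: emeasurable_funM => //.
  exact: measurable_llr.
rewrite /llr_deviation -[X in measurable X]setTI.
exact: (emeasurable_fun_o_infty measurableT mf).
Qed.

Lemma le_sup_deviation I eps k n :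
  (P k (llr_deviation I eps k n) <= sup_deviation I eps n)%E.
Proof. by apply: ereal_sup_ubound; exists k. Qed.

Lemma sup_deviation_ge0 I eps n : (0 <= sup_deviation I eps n)%E.
Proof. exact: le_trans (le_sup_deviation I eps 0 n). Qed.

(** The statistic dominates its summand e^{Z^nu_(nu + j)}; not having crossed h
forces Z^nu_(nu + j) < ln h <= (I - eps) j. *)
Lemma SR_time_gt_deviation (I eps h : R) nu j N : 0 < h -> eps < I ->
  ln h <= (I - eps) * N%:R -> (0 < N <= j)%N ->
  [set w | ((nu + j)%:R%:E < SR_time h w)%E] `<=` llr_deviation I eps nu j.
Proof.
move=> h0 epsI hN /andP[N0 Nj] w /=; rewrite ltNge => /negP gtT.
have j0 : (0 < j)%N by exact: leq_trans Nj.
have SRh : (SR_stat (nu + j) w < h%:E)%E.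
  rewrite ltNge; apply/negP => hSR; apply: gtT; apply/SR_time_leP.
  by exists (nu + j)%N => //; rewrite leqnn addn_gt0 j0 orbT.
have : (expeR (llr nu (nu + j) w) < h%:E)%E.
  apply: le_lt_trans SRh; rewrite /Defs.SR_stat big_add1 /= big_mkord.
  have nuj : (nu < nu + j)%N by rewrite -[ltnLHS]addn0 ltn_add2l.
  rewrite (bigD1 (Ordinal nuj)) //= leeDl //.
  by apply: sume_ge0 => k _; exact: expeR_ge0.
rewrite /llr_deviation /=; case: (llr nu (nu + j) w) => [r| |] //=; last first.
  move=> _; rewrite gt0_muleNy; last by rewrite lte_fin invr_gt0 ltr0n.
  by rewrite addNye /= ltry.
rewrite !lte_fin => rh; have {}rh : r < ln h by rewrite -ltr_expR lnK.
rewrite ltr_normr; apply/orP; right.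
rewrite opprB ltrBrDr -ltrBrDl -(ltr_pM2l (_ : 0 < j%:R)) ?ltr0n //.
rewrite mulrA divff ?pnatr_eq0 -?lt0n // mul1r mulrC.
apply: (lt_le_trans rh); apply: (le_trans hN).
by rewrite ler_pM2l ?subr_gt0 // ler_nat.
Qed.

Lemma stopping_gt_filt (tau : Omega -> \bar R) n : stopping_time X tau ->
  filt X n [set w | (n%:R%:E < tau w)%E].
Proof.
case=> _ /(_ n) Ft; rewrite -filt_measurable in Ft *.
rewrite (_ : [set w | _] = ~` [set w | (tau w <= n%:R%:E)%E]).
  exact: measurableC.
by apply/seteqP; split => w /=; rewrite ltNge => /negP.
Qed.

(** In the tail-sum formula the first N terms are at most 1 each and the others
are bounded by the summable deviation probabilities. Conditioning on nu < T
costs the factor b, as this event has the same probability under Pinf. *)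
Lemma SR_risk_le (I eps h b S : R) N nu : 0 < h -> eps < I -> (0 < N)%N ->
  ln h <= (I - eps) * N%:R -> 0 < b ->
  (\sum_(1 <= n <oo) sup_deviation I eps n <= S%:E)%E ->
  (b^-1%:E <= Pinf [set w | (nu%:R%:E < SR_time h w)%E])%E ->
  (risk P nu (SR_time h) <= (b * (N%:R + S))%:E)%E.
Proof.
move=> h0 epsI N0 hN b0 dev_S pge.
have st := SR_time_stopping h.
rewrite /risk /cond_expect delay_integral //.
rewrite (pre_change_eq (leqnn nu) (@stopping_gt_filt _ nu st)).
have mgt := stopping_gt_measurable nu st.
move: pge; have [p _ ->] := probability_finE Pinf mgt.
rewrite lee_fin => bp.
have p0 : 0 < p by apply: lt_le_trans bp; rewrite invr_gt0.
have : (\sum_(0 <= j <oo) P nu [set w | ((nu + j)%:R%:E < SR_time h w)%E] <=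
    (N%:R + S)%:E)%E.
  rewrite (nneseries_split 0 N) // add0n EFinD leeD //.
    rewrite [leRHS](_ : _ = \sum_(0 <= j < N) 1%E)%E; last first.
      by rewrite sumEFin big_mkord sumr_const card_ord.
    apply: lee_sum => j _; apply: probability_le1.
    exact: (stopping_gt_measurable (nu + j) st).
  apply: le_trans dev_S; rewrite [leRHS](nneseries_split 1 N.-1); last first.
    by move=> j _; exact: sup_deviation_ge0.
  rewrite add1n prednK //; apply: (@le_trans _ _
    (\sum_(N <= j <oo) sup_deviation I eps j)%E); last first.
    by rewrite leeDr // sume_ge0 // => j _; exact: sup_deviation_ge0.
  rewrite eseries_cond [leRHS]eseries_cond.
  apply: lee_nneseries => // j /andP[_ Nj].
  apply: le_trans (le_sup_deviation _ _ nu _).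
  apply: le_measure; rewrite ?inE.
  - exact: (stopping_gt_measurable (nu + j) st).
  - exact: llr_deviation_measurable.
  - by apply: (SR_time_gt_deviation h0 epsI hN); rewrite N0.
rewrite inver gt_eqF // => D_le.
rewrite lee_pdivrMr // -EFinM; apply: (le_trans D_le); rewrite lee_fin.
have : (0 <= (N%:R + S)%:E)%E.
  by apply: le_trans D_le; exact: nneseries_ge0.
rewrite lee_fin => NS0; rewrite mulrAC -[leLHS]mul1r ler_wpM2r //.
by rewrite -(mulfV (lt0r_neq0 b0)) ler_pM2l.
Qed.

(** Where the log-likelihood ratio is at most C, the density of P_nu is at most
e^C. *)
Lemma change_of_measure (C : R) nu n A : (nu < n)%N -> filt X n A ->
  (P nu A <= (expR C)%:E * Pinf A + P nu [set w | C%:E < llr nu n w])%E.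
Proof.
move=> nun FA.
pose B := [set w | (C%:E < llr nu n w)%E].
have mA : measurable A by exact: filt_sub FA.
have FB : filt X n B.
  rewrite -filt_measurable /B -[X in measurable X]setTI.
  exact: (emeasurable_fun_o_infty measurableT (@filt_measurable_llr nu n)).
have mB : measurable B by exact: filt_sub FB.
have FD : filt X n (A `\` B).
  by rewrite -filt_measurable in FA FB *; exact: measurableD.
have mD : measurable (A `\` B) by exact: measurableD.
rewrite -/B (measureDI _ mA mB) leeD //; last first.
  by apply: le_measure; rewrite ?inE //; exact: measurableI.
rewrite [leLHS](model_lr model nun FD).
apply: (@le_trans _ _ (\int[Pinf]_(w in A `\` B) (expR C)%:E)%E).
  apply: ge0_le_integral => //.
  - by move=> w _; exact: expeR_ge0.
  - apply: measurable_funTS.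
    exact: (measurableT_comp measurable_expeR (@measurable_llr nu n)).
  - move=> w [_ /negP]; rewrite -leNgt => llrC.
    by rewrite -[(expR C)%:E]/(expeR C%:E) lee_expeR.
rewrite integral_cst // lee_pmul2l ?lte_fin ?expR_gt0 //.
by apply: le_measure; rewrite ?inE // => w [].
Qed.

(** The positive lower bound q also guarantees that the event nu < tau, on which
the risk conditions, is not negligible. *)
Lemma risk_ge (tau : Omega -> \bar R) nu N (q : R) : stopping_time X tau ->
  0 < q -> (q%:E <= P nu [set w | ((nu + N)%:R%:E < tau w)%E])%E ->
  ((N%:R * q)%:E <= risk P nu tau)%E.
Proof.
move=> st q0 qle; rewrite /risk /cond_expect delay_integral //.
have gt_le j : (j <= N)%N ->
    (q%:E <= P nu [set w | ((nu + j)%:R%:E < tau w)%E])%E.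
  move=> jN; apply: (le_trans qle); apply: le_measure; rewrite ?inE.
  - exact: (stopping_gt_measurable (nu + N) st).
  - exact: (stopping_gt_measurable (nu + j) st).
  - by move=> w /=; apply: le_lt_trans; rewrite lee_fin ler_nat leq_add2l.
have D_ge : ((N%:R * q)%:E <=
    \sum_(0 <= j <oo) P nu [set w | ((nu + j)%:R%:E < tau w)%E])%E.
  apply: le_trans (nneseries_lim_ge N _) => //.
  rewrite [leLHS](_ : _ = \sum_(0 <= j < N) q%:E)%E; last first.
    by rewrite sumEFin big_mkord sumr_const card_ord mulr_natl.
  by rewrite !big_mkord; apply: lee_sum => j _; exact/gt_le/ltnW.
have := gt_le _ (leq0n N); rewrite addn0.
have mgt := stopping_gt_measurable nu st.
have [p /andP[_ p1] ->] := probability_finE (P nu) mgt.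
rewrite lee_fin => qp; have p0 := lt_le_trans q0 qp.
rewrite inver gt_eqF // lee_pdivlMr //; apply: le_trans D_ge.
by rewrite -EFinM lee_fin ler_piMr // mulr_ge0 // ltW.
Qed.

(** The constraint with k = 1: conditioning on tau >= 1 is no condition. *)
Lemma Hstar_prob_le (tau : Omega -> \bar R) beta ks ms n :
  (1 <= ms < ks)%N -> (n <= ms)%N -> Hstar X Pinf beta ks ms tau ->
  (Pinf [set w | tau w <= n%:R%:E] <= beta%:E)%E.
Proof.
move=> /andP[ms1 msks] nms [st Ht]; have mle := stopping_le_measurable _ st.
apply: (@le_trans _ _ (Pinf [set w | tau w <= ms%:R%:E])%E).
  apply: le_measure; rewrite ?inE // => w /= /le_trans; apply.
  by rewrite lee_fin ler_nat.
apply: le_trans Ht; apply: ereal_sup_ubound; exists 1%N.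
  by rewrite /= subn_gt0.
rewrite /cond_prob (_ : [set w | (1%:R%:E <= tau w)%E] = setT); last first.
  apply/seteqP; split=> // w _ /=.
  have [/(_ w)[->|[m m1 ->]] _] := st; first by rewrite leey.
  by rewrite lee_fin ler_nat.
rewrite setIT probability_setT inve1 mule1 add1n; congr (Pinf _).
by apply/seteqP; split => w /=; rewrite (stopping_ltS _ _ st).
Qed.

(** The change of measure with C = (I + eps) N on the event tau <= nu + N: its
Pinf-probability is at most beta as nu + N <= ms, and Z^nu_(nu + N) > C is a
deviation of Z^nu_(nu + N) / N from I by more than eps. *)
Lemma Hstar_risk_ge (tau : Omega -> \bar R) (I eps delta beta : R) ks ms nu N :
  (1 <= ms < ks)%N -> (0 < N)%N -> (nu + N <= ms)%N ->
  Hstar X Pinf beta ks ms tau ->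
  (sup_deviation I eps N <= delta%:E)%E ->
  0 < 1 - (expR ((I + eps) * N%:R) * beta + delta) ->
  ((N%:R * (1 - (expR ((I + eps) * N%:R) * beta + delta)))%:E <=
   risk P nu tau)%E.
Proof.
move=> msks N0 Nms Ht dev_le q0; have [st _] := Ht.
apply: risk_ge => //; rewrite stopping_gt_prob // EFinB leeB // EFinD.
have nuN : (nu < nu + N)%N by rewrite -[ltnLHS]addn0 ltn_add2l.
have Ft : filt X (nu + N) [set w | (tau w <= (nu + N)%:R%:E)%E] by case: st.
apply: (le_trans (change_of_measure ((I + eps) * N%:R) nuN Ft)).
apply: leeD.
  rewrite EFinM lee_pmul2l ?lte_fin ?expR_gt0 //.
  exact: Hstar_prob_le Ht.
apply: le_trans dev_le; apply: le_trans (le_sup_deviation _ _ nu _).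
apply: le_measure; rewrite ?inE.
- rewrite -[X in measurable X]setTI.
  by apply: emeasurable_fun_o_infty => //; exact: measurable_llr.
- exact: llr_deviation_measurable.
move=> w; rewrite /llr_deviation /=.
case: (llr nu (nu + N) w) => [r| |] //=; last first.
  by move=> _; rewrite gt0_muley ?lte_fin ?invr_gt0 ?ltr0n //= ltry.
rewrite !lte_fin => rC; rewrite ltr_normr; apply/orP; left.
rewrite ltrBrDl -(ltr_pM2l (_ : 0 < N%:R)) ?ltr0n //.
by rewrite mulrA divff ?pnatr_eq0 -?lt0n // mul1r mulrC.
Qed.
End changepoint.

(** * Asymptotics of the design parameters *)

Section parameters.
Context {R : realType}.
Implicit Types beta : R.

Lemma near_right0_lt1 : \forall beta \near (0 : R)^'+, 0 < beta < 1.
Proof.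
near=> beta; apply/andP; split; near: beta; first exact: nbhs_right_gt.
exact: nbhs_right_lt.
Unshelve. all: by end_near. Qed.

Lemma abs_ln beta : 0 < beta < 1 -> `|ln beta| = - ln beta.
Proof. by move=> b01; rewrite ltr0_norm // ln_lt0. Qed.

Lemma near_abs_ln_ge (A : R) : \forall beta \near (0 : R)^'+, A <= `|ln beta|.
Proof.
near=> beta.
have b01 : 0 < beta < 1 by near: beta; exact: near_right0_lt1.
rewrite abs_ln // lerNr -[leRHS](expRK) ler_ln ?posrE ?expR_gt0 //.
near: beta; apply: nbhs_right_le; exact: expR_gt0.
Unshelve. all: by end_near. Qed.

Lemma rho1_gt0_lt1 beta : 0 < beta < 1 -> 0 < rho1 beta < 1.
Proof.
move=> b01; have l0 : 0 < `|ln beta| by rewrite abs_ln // oppr_gt0 ln_lt0.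
by rewrite invr_gt0 invf_lt1 ?ltrDl ?l0 ?andbT ?addr_gt0.
Qed.

Lemma rho2_gt0_le beta : 0 < beta < 1 -> 0 < rho2 beta <= rho1 beta.
Proof.
move=> /rho1_gt0_lt1/andP[r0 _].
have d0 : 0 < 1 + `|ln `|ln beta| | by rewrite ltr_pwDl.
rewrite divr_gt0 //= ler_pdivrMr // ler_peMr ?lerDl //; exact: ltW.
Qed.

Lemma onem_expM_le1 k (r : R) :
  0 <= r <= 1 -> (1 - r) ^+ k * (1 + k%:R * r) <= 1.
Proof.
move=> /andP[r0 r1]; elim: k => [|k IHk].
  by rewrite expr0 mul0r addr0 mul1r.
apply: le_trans IHk; rewrite exprSr -mulrA ler_wpM2l ?exprn_ge0 ?subr_ge0 //.
rewrite -[k.+1]addn1 natrD.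
by have := ler0n R k; nra.
Qed.

(** As beta / (1 + beta) <= 1, alpha3 is at most (1 - rho2)^ks, and the sum is
at most (1 - rho2)^ks (1 + ks rho2) <= 1. *)
Lemma alpha3_bound ks beta : 0 < beta < 1 ->
  0 < alpha3 ks beta /\
  alpha3 ks beta + (ks beta)%:R * rho2 beta * (1 - rho2 beta) ^+ ks beta <= 1.
Proof.
move=> b01; have /andP[r0 r1] := rho2_gt0_le b01.
have /andP[_ r11] := rho1_gt0_lt1 b01; have {r11}r1 := le_lt_trans r1 r11.
have /andP[b0 b1] := b01.
have q0 : 0 < (1 - rho2 beta) ^+ ks beta by rewrite exprn_gt0 // subr_gt0.
split; first by rewrite /alpha3 divr_gt0 ?mulr_gt0 // addr_gt0.
have : 0 <= rho2 beta <= 1 by rewrite !ltW.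
move=> /(onem_expM_le1 (ks beta)).
apply: le_trans; rewrite mulrDr mulr1 [X in _ <= _ + X]mulrC lerD2r /alpha3.
rewrite ler_pdivrMr ?addr_gt0 // mulrC ler_wpM2l ?(ltW q0) //.
by rewrite lerDr.
Qed.

Lemma hstar_gt0_ge ks beta : 0 < beta < 1 ->
  (0 < ks beta)%N ->
  0 < hstar ks beta /\ (ks beta)%:R * (1 + beta) <= beta * hstar ks beta.
Proof.
move=> b01 k0; have /andP[r0 r1] := rho2_gt0_le b01.
have /andP[_ r11] := rho1_gt0_lt1 b01; have {r11}r1 := le_lt_trans r1 r11.
have /andP[b0 b1] := b01.
have [a0 ale] := alpha3_bound ks b01.
have q0 : 0 < (1 - rho2 beta) ^+ ks beta by rewrite exprn_gt0 // subr_gt0.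
have k0' : 0 < (ks beta)%:R :> R by rewrite ltr0n.
have a1 : 0 < 1 - alpha3 ks beta.
  rewrite subr_gt0; apply: lt_le_trans ale; rewrite ltrDl.
  by apply: mulr_gt0 => //; exact: mulr_gt0.
split; first by rewrite /hstar divr_gt0 // mulr_gt0.
rewrite /hstar mulrA ler_pdivlMr; last exact: mulr_gt0.
rewrite {1}/alpha3.
rewrite [leLHS](_ : _ =
    beta * ((ks beta)%:R * rho2 beta * (1 - rho2 beta) ^+ ks beta)).
  by rewrite ler_pM2l // lerBrDl.
by field; rewrite gt_eqF // addr_gt0.
Qed.

(** From e^(d l) = (e^(d l / 2))^2 >= (1 + d l / 2)^2 >= 1 + l, the last step
being where l >= 4 / d^2 enters. *)
Lemma ln1D_le (d l : R) : 0 < d -> 4 / d ^+ 2 <= l -> ln (1 + l) <= d * l.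
Proof.
move=> d0; rewrite ler_pdivrMr ?exprn_gt0 // => hl.
have d20 : 0 < d ^+ 2 by rewrite exprn_gt0.
have l0 : 0 < l by rewrite -(pmulr_lgt0 _ d20); apply: lt_le_trans hl.
rewrite -[leRHS]expRK ler_ln ?posrE ?expR_gt0 ?addr_gt0 //.
have e1 := expR_ge1Dx (d * l / 2).
rewrite [in leRHS](splitr (d * l)) expRD.
apply: (@le_trans _ _ ((1 + d * l / 2) * (1 + d * l / 2))); first by nra.
by apply: ler_pM => //; rewrite addr_ge0 ?divr_ge0 ?mulr_ge0 // ltW.
Qed.

(** With l = |ln beta| >= 1, 1 / rho2 = (1 + l) (1 + |ln l|) <= (1 + l)^2, whose
logarithm is o(l). *)
Lemma near_ln_rho2 (d : R) : 0 < d ->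
  \forall beta \near (0 : R)^'+, - ln (rho2 beta) <= d * `|ln beta|.
Proof.
move=> d0; have d20 : 0 < d / 2 by rewrite divr_gt0.
near=> beta.
have b01 : 0 < beta < 1 by near: beta; exact: near_right0_lt1.
have l1 : 1 <= `|ln beta| by near: beta; exact: near_abs_ln_ge.
have ld : 4 / (d / 2) ^+ 2 <= `|ln beta| by near: beta; exact: near_abs_ln_ge.
have /andP[r0 _] := rho2_gt0_le b01.
rewrite -lnV // /rho2 /rho1 invfM !invrK.
have := ln1D_le d20 ld; set l := `|ln beta| in l1 ld *.
have l0 : 0 < l by apply: lt_le_trans l1.
have ll : 0 <= ln l by rewrite ln_ge0.
have l10 : 0 < 1 + l by exact: addr_gt0.
have ll0 : 0 < 1 + ln l by rewrite ltr_pwDl.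
move=> ln1l; rewrite (ger0_norm ll) lnM ?posrE //.
rewrite [leRHS](_ : _ = d / 2 * l + d / 2 * l); last by field.
apply: lerD => //; apply: le_trans ln1l.
by rewrite ler_ln // lerD2l ltW // ln_sublinear.
Unshelve. all: by end_near. Qed.

(** 1 / (rho2 alpha3) bounds hstar from above. *)
Lemma near_ln_hstar ks (e : R) : 0 < e ->
  (forall beta, 0 < beta < 1 -> (0 < ks beta)%N) ->
  `|ln (alpha3 ks beta)| / `|ln beta| @[beta --> 0^'+] --> (1 : R) ->
  \forall beta \near (0 : R)^'+, ln (hstar ks beta) <= (1 + e) * `|ln beta|.
Proof.
move=> e0 ks0 lim3; have e20 : 0 < e / 2 by rewrite divr_gt0.
near=> beta.
have b01 : 0 < beta < 1 by near: beta; exact: near_right0_lt1.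
have l0 : 0 < `|ln beta| by rewrite abs_ln // oppr_gt0 ln_lt0.
have r2 : - ln (rho2 beta) <= e / 2 * `|ln beta|.
  by near: beta; exact: near_ln_rho2.
have : `|ln (alpha3 ks beta)| / `|ln beta| < 1 + e / 2.
  by near: beta; apply: (cvgr_lt _ lim3); rewrite ltrDl.
rewrite ltr_pdivrMr // => a3.
have [a0 _] := alpha3_bound ks b01.
have /andP[r0 _] := rho2_gt0_le b01.
have [h0 _] := hstar_gt0_ge b01 (ks0 _ b01).
have p0 : 0 < rho2 beta * alpha3 ks beta by exact: mulr_gt0.
apply: (@le_trans _ _ (ln (rho2 beta * alpha3 ks beta)^-1)).
  rewrite ler_ln ?posrE ?invr_gt0 // ler_piMl ?invr_ge0 ?(ltW p0) //.
  by rewrite gerBl ltW.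
rewrite lnV // lnM ?posrE // opprD.
have a3' := ler_norm (- ln (alpha3 ks beta)); rewrite normrN in a3'.
lra.
Unshelve. all: by end_near. Qed.

(** Let l = |ln beta|. Since (1 - rho1)^(ms + 1) <= alpha1 and
|ln alpha1| >= l / 2, while ln (1 - rho1) = - ln (1 + 1 / l) >= - 1 / l, one
gets ms + 1 >= l^2 / 2, which exceeds any multiple of l. The case alpha1 >= 1
is excluded for l > 2, because then |ln alpha1| <= 1. *)
Lemma near_ms_ge ms (A : R) :
  `|ln (alpha1 ms beta)| / `|ln beta| @[beta --> 0^'+] --> (1 : R) ->
  \forall beta \near (0 : R)^'+, A * `|ln beta| <= (ms beta)%:R.
Proof.
move=> lim1; near=> beta.
have b01 : 0 < beta < 1 by near: beta; exact: near_right0_lt1.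
have l2 : 2 < `|ln beta|.
  by apply: (@lt_le_trans _ _ 3); [lra|near: beta; exact: near_abs_ln_ge].
have lA : 2 * A + 2 <= `|ln beta| by near: beta; exact: near_abs_ln_ge.
have : 1 / 2 < `|ln (alpha1 ms beta)| / `|ln beta|.
  by near: beta; apply: (cvgr_gt _ lim1); lra.
have /andP[r0 r1] := rho1_gt0_lt1 b01.
have /andP[b0 b1] := b01.
have q0 : 0 < (1 - rho1 beta) ^+ (ms beta).+1 by rewrite exprn_gt0 // subr_gt0.
have q1 : (1 - rho1 beta) ^+ (ms beta).+1 <= 1.
  by rewrite exprn_ile1 ?subr_ge0 ?gerBl // ltW.
have a0 : 0 < alpha1 ms beta by rewrite addr_gt0.
have qa : (1 - rho1 beta) ^+ (ms beta).+1 <= alpha1 ms beta.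
  by rewrite lerDr ltW.
set l := `|ln beta| in l2 lA *; have l0 : 0 < l by lra.
rewrite ltr_pdivlMr // => la1.
have ln_a : ln (alpha1 ms beta) <= alpha1 ms beta - 1.
  have -> : ln (alpha1 ms beta) = ln (1 + (alpha1 ms beta - 1)).
    by congr ln; ring.
  by apply: le_ln1Dx; lra.
have a2 : alpha1 ms beta <= 2 by rewrite /alpha1; lra.
have {}la1 : ln (alpha1 ms beta) <= - (l / 2).
  have [ln0|ln0] := leP 0 (ln (alpha1 ms beta)).
    by move: la1; rewrite ger0_norm //; lra.
  by move: la1; rewrite ltr0_norm //; lra.
have : ln ((1 - rho1 beta) ^+ (ms beta).+1) <= - (l / 2).
  by apply: le_trans la1; rewrite ler_ln ?posrE.
rewrite lnXn ?subr_gt0 // -mulr_natr.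
have -> : 1 - rho1 beta = (1 + l^-1)^-1.
  by rewrite /rho1 -/l; field; rewrite !gt_eqF ?addr_gt0.
have il0 : 0 < l^-1 by rewrite invr_gt0.
have lnl : ln (1 + l^-1) <= l^-1 by apply: le_ln1Dx; lra.
rewrite lnV ?posrE ?addr_gt0 // => ml.
have m0 : 0 <= (ms beta).+1%:R :> R by [].
have ml2 : l / 2 <= l^-1 * (ms beta).+1%:R.
  by have := ler_wpM2r m0 lnl; lra.
have := ler_wpM2l (ltW l0) ml2; rewrite [leRHS]mulrA mulfV ?gt_eqF // mul1r.
by rewrite -[in (ms beta).+1]addn1 natrD; nra.
Unshelve. all: by end_near. Qed.

End parameters.

(** * Equivalence through two-sided bounds *)

(** For L positive this is the equivalence of a and L at 0, stated by two
inequalities because a takes extended values. *)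
Definition within_factor {R : realType} (L : R -> R) (a : R -> \bar R) : Prop :=
  forall e : R, 0 < e < 1 -> \forall beta \near 0^'+,
    (((1 - e) * L beta)%:E <= a beta <= ((1 + e) * L beta)%:E)%E.

Lemma within_factor_ratio {R : realType} (L : R -> R) (a b : R -> \bar R) :
  (\forall beta \near 0^'+, 0 < L beta) ->
  within_factor L a -> within_factor L b ->
  (a beta / b beta)%E @[beta --> 0^'+] --> 1%E.
Proof.
move=> L0 aL bL; apply/fine_cvgP.
have half01 : 0 < (2^-1 : R) < 1 by apply/andP; split; lra.
have key (e beta : R) : 0 < e < 1 -> 0 < L beta ->
    (((1 - e) * L beta)%:E <= a beta <= ((1 + e) * L beta)%:E)%E ->
    (((1 - e) * L beta)%:E <= b beta <= ((1 + e) * L beta)%:E)%E ->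
    exists2 r : R, (a beta / b beta)%E = r%:E & `|1 - r| <= 2 * e / (1 - e).
  move=> /andP[e0 e1] Lb /andP[]; case: (a beta) => [x| |] //; rewrite !lee_fin.
  move=> ax xa /andP[]; case: (b beta) => [y| |] //; rewrite !lee_fin => by_ yb.
  have l0 : 0 < (1 - e) * L beta by rewrite mulr_gt0 // subr_gt0.
  have y0 : 0 < y by apply: lt_le_trans by_.
  exists (x / y); first by rewrite inver gt_eqF.
  rewrite -[X in `|X - _|](divff (lt0r_neq0 y0)) -mulrBl normrM normfV.
  rewrite (gtr0_norm y0).
  rewrite ler_pdivrMr //.
  apply: (@le_trans _ _ (2 * e * L beta)).
    by rewrite ler_norml; apply/andP; split; lra.
  have Ly : L beta <= (1 - e)^-1 * y by rewrite ler_pdivlMl ?subr_gt0.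
  by rewrite -[leRHS]mulrA ler_wpM2l // mulr_ge0 // ltW.
split.
  near=> beta.
  have [r -> _] : exists2 r : R, (a beta / b beta)%E = r%:E &
      `|1 - r| <= 2 * 2^-1 / (1 - 2^-1).
    apply: key => //; near: beta => //; [exact: aL|exact: bL].
  by [].
apply/cvgrPdist_le => d d0.
have [e e01 ed] : exists2 e : R, 0 < e < 1 & 2 * e / (1 - e) <= d.
  (* With this e, 2 e / (1 - e) = 2 d / (4 + d), which is at most d. *)
  exists (d / (4 + 2 * d)).
    by rewrite divr_gt0 ?ltr_pdivrMr ?mul1r; lra.
  rewrite ler_pdivrMr; last first.
    by rewrite subr_gt0 ltr_pdivrMr ?mul1r; lra.
  have -> : d * (1 - d / (4 + 2 * d)) = (4 * d + d ^+ 2) / (4 + 2 * d).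
    by field; rewrite gt_eqF //; lra.
  by rewrite mulrA ler_pM2r ?invr_gt0; nra.
near=> beta; rewrite /=.
have [r -> re] : exists2 r : R, (a beta / b beta)%E = r%:E &
    `|1 - r| <= 2 * e / (1 - e).
  by apply: key => //; near: beta => //; [exact: aL|exact: bL].
exact: le_trans ed.
Unshelve. all: by end_near. Qed.

(** * First-order optimality *)

Section optimality.
Context {R : realType} {dO dE : measure_display}
  {Omega : measurableType dO} {E : measurableType dE}.
Variables (mu : {sigma_finite_measure set E -> \bar R}) (X : nat -> Omega -> E)
  (f0 : density_family E R) (f1 : nat -> density_family E R)
  (Pinf : probability Omega R) (P : nat -> probability Omega R).
Hypothesis model : changepoint_model mu X f0 f1 Pinf P.
Variables (ms ks : R -> nat).
Hypothesis ms_ge1 : forall beta, 0 < beta < 1 -> (1 <= ms beta)%N.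
Hypothesis ks_gtm : forall beta, 0 < beta < 1 -> (ms beta < ks beta)%N.
Hypothesis lim_alpha1 :
  `|ln (alpha1 ms beta)| / `|ln beta| @[beta --> 0^'+] --> (1 : R).
Hypothesis lim_alpha3 :
  `|ln (alpha3 ks beta)| / `|ln beta| @[beta --> 0^'+] --> (1 : R).

Local Notation T := (fun beta => SR_time X f0 f1 (hstar ks beta)).
Local Notation H := (fun beta => Hstar X Pinf beta (ks beta) (ms beta)).

Lemma ks_gt0 beta : 0 < beta < 1 -> (0 < ks beta)%N.
Proof. by move=> b01; apply: leq_ltn_trans (ks_gtm b01). Qed.

Lemma SR_time_in_Hstar beta : 0 < beta < 1 -> H beta (T beta).
Proof.
move=> b01; have [h0 hk] := hstar_gt0_ge b01 (ks_gt0 b01).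
exact: (SR_time_Hstar model).
Qed.

Variable I : R.
Hypothesis I0 : 0 < I.
Hypothesis dev_summable : forall eps : R, 0 < eps ->
  (\sum_(1 <= n <oo) sup_deviation X f0 f1 P I eps n < +oo)%E.

Local Notation L := (fun beta => `|ln beta| / I).

Lemma near_L_ge (A : R) : \forall beta \near 0^'+, A <= L beta.
Proof.
near=> beta; rewrite ler_pdivlMr //.
by near: beta; exact: near_abs_ln_ge.
Unshelve. all: by end_near. Qed.

Lemma near_ks_ge n : \forall beta \near (0 : R)^'+, (n <= ks beta)%N.
Proof.
near=> beta.
have b01 : 0 < beta < 1 by near: beta; exact: near_right0_lt1.
apply: leq_trans (ltnW (ks_gtm b01)).
rewrite -(ler_nat R); apply: (@le_trans _ _ (1 * `|ln beta|)).
  by rewrite mul1r; near: beta; exact: near_abs_ln_ge.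
by near: beta; exact: near_ms_ge.
Unshelve. all: by end_near. Qed.

Lemma near_sup_deviation_le (eps d : R) : 0 < eps -> 0 < d ->
  exists n0, forall n, (n0 <= n)%N ->
    (sup_deviation X f0 f1 P I eps n <= d%:E)%E.
Proof.
move=> eps0 d0; pose u n := sup_deviation X f0 f1 P I eps (n + 1).
have u0 n : (0 <= u n)%E by exact: sup_deviation_ge0.
have : (\sum_(N <= k <oo) u k)%E @[N --> \oo] --> 0%E.
  apply: nneseries_tail_cvg => //; rewrite nneseries_addn; last first.
    by move=> i; exact: sup_deviation_ge0.
  exact: dev_summable.
move=> /fine_cvgP[fin /cvgrPdist_le /(_ d d0)] dist.
have [n0 _ Hn0] := filterI fin dist.
exists n0.+1 => -[//|n]; rewrite ltnS => n0n; have [finn /=] := Hn0 n n0n.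
rewrite sub0r normrN => tail_le.
apply: (@le_trans _ _ (\sum_(n <= k <oo) u k)%E); last first.
  by rewrite -(fineK finn) lee_fin; apply: le_trans tail_le; exact: ler_norm.
rewrite (nneseries_split n 1) // addn1 big_nat1 /u addn1 leeDl //.
by apply: nneseries_ge0 => k _ _; exact: sup_deviation_ge0.
Qed.

(** The deviation level in [Hstar_risk_ge] is e I, so that the exponent
(I + e I) N is at most (1 + e) (1 - e) l with l = |ln beta|, and multiplication
by beta = exp (- l) leaves exp (- e^2 l), which tends to 0. *)
Lemma near_Hstar_risk_ge nu (eps : R) : 0 < eps < 1 ->
  \forall beta \near (0 : R)^'+, forall tau, H beta tau ->
    (((1 - eps) * L beta)%:E <= risk P nu tau)%E.
Proof.
move=> /andP[eps0 eps1].
(* One e goes into N, one into each of the two error probabilities, and one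
   into the rounding of N. *)
pose e := eps / 4; have e0 : 0 < e by rewrite divr_gt0.
have epsE : eps = 4 * e by rewrite /e; field.
have eI0 : 0 < e * I by exact: mulr_gt0.
have [n0 dev_le] := near_sup_deviation_le eI0 e0.
near=> beta => tau Htau.
have b01 : 0 < beta < 1 by near: beta; exact: near_right0_lt1.
have L1 : e^-1 <= L beta by near: beta; exact: near_L_ge.
have Ln0 : n0.+1%:R / (1 - e) <= L beta by near: beta; exact: near_L_ge.
have lbig : e^-1 / e ^+ 2 <= `|ln beta| by near: beta; exact: near_abs_ln_ge.
have nuL : nu%:R * I <= `|ln beta| by near: beta; exact: near_abs_ln_ge.
(* One multiple of |ln beta| / I leaves room for nu, the other for N. *)
have msL : (I^-1 + I^-1) * `|ln beta| <= (ms beta)%:R.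
  by near: beta; exact: near_ms_ge.
have l0 : 0 < `|ln beta| by rewrite abs_ln // oppr_gt0 ln_lt0.
have /andP[b0 b1] := b01.
set l := `|ln beta| in l0 L1 Ln0 lbig nuL msL *.
pose N := Num.truncn ((1 - e) * (l / I)).
have e4 : e < 1 / 4 by lra.
have x0 : 0 <= (1 - e) * (l / I).
  by rewrite mulr_ge0 // ?divr_ge0 // ?ltW //; lra.
have /andP[Nle Ngt] := truncn_itv x0.
rewrite -/N in Nle Ngt.
have n0N : (n0.+1 <= N)%N.
  rewrite -ltnS -(ltr_nat R); apply: le_lt_trans Ngt.
  move: Ln0; rewrite ler_pdivrMr; last by lra.
  by rewrite mulrC.
have N0 : (0 < N)%N by exact: leq_ltn_trans n0N.
have Nms : (nu + N <= ms beta)%N.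
  rewrite -(ler_nat R) natrD; apply: le_trans msL; rewrite mulrDl lerD //.
    by rewrite ler_pdivlMl // mulrC.
  apply: (le_trans Nle); rewrite mulrC [leRHS]mulrC.
  by rewrite ler_piMr ?divr_ge0 ?(ltW l0) ?(ltW I0) //; lra.
have msks : (1 <= ms beta < ks beta)%N by rewrite ms_ge1 // ks_gtm.
have dN := dev_le N (ltnW n0N).
have exp_le : expR ((I + e * I) * N%:R) * beta <= e.
  rewrite -[X in _ * X](lnK b0) -expRD.
  have lnb : ln beta = - l by rewrite /l abs_ln // opprK.
  apply: (@le_trans _ _ (expR (- (e ^+ 2 * l)))).
    rewrite ler_expR lnb.
    have IN : I * N%:R <= (1 - e) * l.
      have := ler_wpM2l (ltW I0) Nle.
      by rewrite mulrCA [I * (_ / _)]mulrC divfK ?gt_eqF.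
    have : (1 + e) * (I * N%:R) <= (1 + e) * ((1 - e) * l).
      by rewrite ler_wpM2l //; lra.
    by rewrite expr2; lra.
  rewrite expRN -[leRHS]invrK lef_pV2 ?posrE ?invr_gt0 ?expR_gt0 //.
  apply: le_trans (expR_ge1Dx _); move: lbig.
  rewrite ler_pdivrMr ?exprn_gt0 // mulrC => lbig.
  by apply: (le_trans lbig); rewrite lerDr.
apply: (@le_trans _ _ (N%:R * (1 - (expR ((I + e * I) * N%:R) * beta + e)))%:E);
  last first.
  apply: (Hstar_risk_ge model msks N0 Nms Htau dN).
  by lra.
rewrite lee_fin; apply: (@le_trans _ _ (N%:R * (1 - 2 * e))); last first.
  by rewrite ler_wpM2l //; lra.
apply: (@le_trans _ _ (((1 - e) * (l / I) - 1) * (1 - 2 * e))); last first.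
  rewrite ler_wpM2r //; first by lra.
  by rewrite lerBlDr natr1 ltW.
have eL : 1 <= e * (l / I) by rewrite mulrC -ler_pdivrMr // div1r.
by rewrite epsE; nra.
Unshelve. all: by end_near. Qed.

(** N is about (1 + e) / (1 - e) times |ln beta| / I; the sum S of the deviation
probabilities does not depend on beta or nu, which makes the bound uniform in
nu. *)
Lemma near_SR_risk_le (eps : R) : 0 < eps < 1 ->
  \forall beta \near (0 : R)^'+, forall nu, (nu <= ks beta)%N ->
    (risk P nu (T beta) <= ((1 + eps) * L beta)%:E)%E.
Proof.
move=> /andP[eps0 eps1].
(* (1 + e)^2 / (1 - e) <= 1 + 5 e for e < 1 / 6; the sixth e absorbs S. *)
pose e := eps / 6; have e0 : 0 < e by rewrite divr_gt0.
have epsE : eps = 6 * e by rewrite /e; field.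
have eI0 : 0 < e * I by exact: mulr_gt0.
have e6 : e < 1 / 6 by lra.
have eI : e * I < I by rewrite gtr_pMl //; lra.
have S0 : (0 <= \sum_(1 <= n <oo) sup_deviation X f0 f1 P I (e * I) n)%E.
  by apply: nneseries_ge0 => n _ _; exact: sup_deviation_ge0.
have := dev_summable eI0; rewrite -ge0_fin_numE // => /fineK Sfin.
set S := fine _ in Sfin; have {S0}S0 : 0 <= S by rewrite -lee_fin Sfin.
near=> beta => nu nuk.
have b01 : 0 < beta < 1 by near: beta; exact: near_right0_lt1.
have be : beta <= e by near: beta; exact: nbhs_right_le.
have lnh : ln (hstar ks beta) <= (1 + e) * `|ln beta|.
  by near: beta; apply: near_ln_hstar => //; exact: ks_gt0.
have LS : (2 * (1 + S)) / e <= L beta by near: beta; exact: near_L_ge.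
have /andP[b0 b1] := b01.
have l0 : 0 < `|ln beta| by rewrite abs_ln // oppr_gt0 ln_lt0.
set l := `|ln beta| in lnh LS l0 *.
have [h0 hk] := hstar_gt0_ge b01 (ks_gt0 b01).
pose x := (1 + e) / (1 - e) * (l / I).
have ed0 : 0 < 1 - e by lra.
have x0 : 0 <= x by rewrite !mulr_ge0 ?invr_ge0 ?ltW //; lra.
pose N := (Num.truncn x).+1.
have hN : ln (hstar ks beta) <= (I - e * I) * N%:R.
  apply: (le_trans lnh).
  apply: (@le_trans _ _ ((I - e * I) * x)).
    rewrite le_eqVlt; apply/orP; left; apply/eqP; rewrite /x; field.
    by rewrite !gt_eqF.
  by rewrite ler_wpM2l ?subr_ge0 ?(ltW eI) // ltW // truncnS_gt.
have b10 : 0 < 1 + beta by exact: addr_gt0.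
have dev_S : (\sum_(1 <= n <oo) sup_deviation X f0 f1 P I (e * I) n <= S%:E)%E.
  by rewrite Sfin.
have pge := SR_time_gt_Pinf model b01 h0 hk nuk.
apply: (le_trans (SR_risk_le model h0 eI (ltn0Sn _) hN b10 dev_S pge)).
rewrite lee_fin.
have Nx : N%:R <= x + 1 by rewrite /N -natr1 lerD2r truncn_le.
apply: (@le_trans _ _ ((1 + e) * (x + 1 + S))).
  apply: ler_pM; [exact: ltW|exact: addr_ge0| |]; first by rewrite lerD2l.
  by rewrite lerD2r.
have L0 : 0 < l / I by exact: divr_gt0.
have xle : (1 + e) * x <= (1 + 5 * e) * (l / I).
  rewrite /x mulrA ler_wpM2r ?(ltW L0) // mulrA ler_pdivrMr //.
  by nra.
have LS' : 2 * (1 + S) <= e * (l / I) by rewrite [leRHS]mulrC -ler_pdivrMr.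
rewrite epsE.
have : (1 + e) * (1 + S) <= 2 * (1 + S) by rewrite ler_wpM2r //; lra.
by lra.
Unshelve. all: by end_near. Qed.

Lemma within_factor_between (a : R -> \bar R) :
  (forall e : R, 0 < e < 1 -> \forall beta \near (0 : R)^'+,
    (((1 - e) * L beta)%:E <= a beta)%E) ->
  (forall e : R, 0 < e < 1 -> \forall beta \near (0 : R)^'+,
    (a beta <= ((1 + e) * L beta)%:E)%E) ->
  within_factor L a.
Proof.
move=> lo up e e01; near=> beta; apply/andP; split; near: beta.
  exact: lo.
exact: up.
Unshelve. all: by end_near. Qed.

Lemma SR_risk_within_factor nu :
  within_factor L (fun beta => risk P nu (T beta)).
Proof.
apply: within_factor_between => e e01; near=> beta.
  have b01 : 0 < beta < 1 by near: beta; exact: near_right0_lt1.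
  have : forall tau, H beta tau -> (((1 - e) * L beta)%:E <= risk P nu tau)%E.
    by near: beta; exact: near_Hstar_risk_ge.
  by apply; exact: SR_time_in_Hstar.
have up nu' : (nu' <= ks beta)%N ->
    (risk P nu' (T beta) <= ((1 + e) * L beta)%:E)%E.
  by move: nu'; near: beta; exact: near_SR_risk_le.
by apply: up; near: beta; exact: near_ks_ge.
Unshelve. all: by end_near. Qed.

Lemma inf_risk_within_factor nu :
  within_factor L (fun beta => ereal_inf [set risk P nu tau | tau in H beta]).
Proof.
apply: within_factor_between => e e01; near=> beta.
  apply: le_ereal_inf_tmp => _ [tau Htau <-].
  by move: tau Htau; near: beta; exact: near_Hstar_risk_ge.
have b01 : 0 < beta < 1 by near: beta; exact: near_right0_lt1.
apply: (@le_trans _ _ (risk P nu (T beta))).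
  by apply: ereal_inf_lbound; exists (T beta) => //; exact: SR_time_in_Hstar.
have up nu' : (nu' <= ks beta)%N ->
    (risk P nu' (T beta) <= ((1 + e) * L beta)%:E)%E.
  by move: nu'; near: beta; exact: near_SR_risk_le.
by apply: up; near: beta; exact: near_ks_ge.
Unshelve. all: by end_near. Qed.

Section worst_case.
(** The worst risk over change points up to ks occurs both as an iterated
maximum and as a supremum; the two hypotheses on M hold for either form. *)
Variable M : R -> (Omega -> \bar R) -> \bar R.
Hypothesis risk_le_M : forall beta tau, (risk P 0 tau <= M beta tau)%E.
Hypothesis M_le : forall beta tau x,
  (forall nu, (nu <= ks beta)%N -> (risk P nu tau <= x)%E) ->
  (M beta tau <= x)%E.

Lemma SR_worst_within_factor : within_factor L (fun beta => M beta (T beta)).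
Proof.
apply: within_factor_between => e e01; near=> beta.
  have b01 : 0 < beta < 1 by near: beta; exact: near_right0_lt1.
  apply: le_trans (risk_le_M _ _).
  have : forall tau, H beta tau -> (((1 - e) * L beta)%:E <= risk P 0 tau)%E.
    by near: beta; exact: near_Hstar_risk_ge.
  by apply; exact: SR_time_in_Hstar.
by apply: M_le; near: beta; exact: near_SR_risk_le.
Unshelve. all: by end_near. Qed.

Lemma inf_worst_within_factor :
  within_factor L (fun beta => ereal_inf [set M beta tau | tau in H beta]).
Proof.
apply: within_factor_between => e e01; near=> beta.
  apply: le_ereal_inf_tmp => _ [tau Htau <-].
  apply: le_trans (risk_le_M _ _).
  by move: tau Htau; near: beta; exact: near_Hstar_risk_ge.
have b01 : 0 < beta < 1 by near: beta; exact: near_right0_lt1.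
apply: (@le_trans _ _ (M beta (T beta))).
  by apply: ereal_inf_lbound; exists (T beta) => //; exact: SR_time_in_Hstar.
by apply: M_le; near: beta; exact: near_SR_risk_le.
Unshelve. all: by end_near. Qed.

End worst_case.

End optimality.

Theorem theorem7 (R : realType) (dO dE : measure_display)
  (Omega : measurableType dO) (E : measurableType dE)
  (mu : {sigma_finite_measure set E -> \bar R})
  (X : nat -> Omega -> E)
  (f0 : density_family E R) (f1 : nat -> density_family E R)
  (Pinf : probability Omega R) (P : nat -> probability Omega R)
  (model : changepoint_model mu X f0 f1 Pinf P)
  (ms ks : R -> nat)
  (ms_ge1 : forall beta : R, 0 < beta < 1 -> (1 <= ms beta)%N)
  (ks_gtm : forall beta : R, 0 < beta < 1 -> (ms beta < ks beta)%N)
  (lim_alpha1 : `|ln (alpha1 ms beta)| / `|ln beta| @[beta --> 0^'+] --> (1 : R))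
  (lim_gap : `|ln (alpha3 ks beta)| + (ks beta)%:R * ln (1 - rho2 beta)
               @[beta --> (0 : R)^'+] --> +oo)
  (lim_alpha3 : `|ln (alpha3 ks beta)| / `|ln beta| @[beta --> 0^'+] --> (1 : R)) :
  let H := fun beta : R => Hstar X Pinf beta (ks beta) (ms beta) in
  let T := fun beta : R => SR_time X f0 f1 (hstar ks beta) in
  (forall beta : R, 0 < beta < 1 -> H beta (T beta)) /\
  (forall I : R, 0 < I ->
    (forall eps : R, 0 < eps ->
      (\sum_(1 <= n <oo)
         ereal_sup [set P k [set w | eps%:E <
                        `| (n%:R^-1)%:E * llr X f0 f1 k (k + n) w - I%:E | ]
                   | k in [set: nat]] < +oo)%E) ->
    [/\ forall nu : nat,
          (ereal_inf [set risk P nu tau | tau in H beta]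
           / risk P nu (T beta))%E @[beta --> 0^'+] --> 1%E,
        (ereal_inf [set \big[maxe/-oo]_(0 <= nu < (ks beta).+1) risk P nu tau
                   | tau in H beta]
         / \big[maxe/-oo]_(0 <= nu < (ks beta).+1) risk P nu (T beta))%E
          @[beta --> 0^'+] --> 1%E,
        forall nu : nat,
          asymp_eq (fun beta => risk P nu (T beta))
            (fun beta => ereal_inf [set risk P nu tau | tau in H beta]) /\
          asymp_eq
            (fun beta => ereal_inf [set risk P nu tau | tau in H beta])
            (fun beta => (`|ln beta| / I)%:E) &
        asymp_eq
          (fun beta => ereal_sup [set risk P nu (T beta)
                                 | nu in [set nu | (nu <= ks beta)%N]])
          (fun beta => ereal_inf
             [set ereal_sup [set risk P nu tau
                            | nu in [set nu | (nu <= ks beta)%N]]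
             | tau in H beta]) /\
        asymp_eq
          (fun beta => ereal_inf
             [set ereal_sup [set risk P nu tau
                            | nu in [set nu | (nu <= ks beta)%N]]
             | tau in H beta])
          (fun beta => (`|ln beta| / I)%:E)]).
Proof.
move=> H T; have ks0 := ks_gt0 ks_gtm.
split=> [beta b01|I I0 dev]; first exact: (SR_time_in_Hstar model ks_gtm).
pose L beta := `|ln beta| / I.
have L0 : \forall beta \near 0^'+, 0 < L beta.
  near=> beta; apply: (@lt_le_trans _ _ 1) => //.
  by near: beta; exact: (near_L_ge I0).
have LL : within_factor L (fun beta => (L beta)%:E).
  move=> e /andP[e0 e1]; near=> beta.
  have Lb : 0 < L beta by near: beta.
  rewrite !lee_fin ler_piMl ?ler_peMl ?lerDl ?gerBl // ltW //.
have Trisk nu : within_factor L (fun beta => risk P nu (T beta)).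
  exact: (SR_risk_within_factor model ms_ge1 ks_gtm lim_alpha1
    lim_alpha3 I0 dev).
have Hrisk nu : within_factor L
    (fun beta => ereal_inf [set risk P nu tau | tau in H beta]).
  exact: (inf_risk_within_factor model ms_ge1 ks_gtm lim_alpha1
    lim_alpha3 I0 dev).
pose Mmax beta tau := \big[maxe/-oo%E]_(0 <= nu < (ks beta).+1) risk P nu tau.
pose Msup beta tau :=
  ereal_sup [set risk P nu tau | nu in [set nu | (nu <= ks beta)%N]].
have Mmax_ge beta tau : (risk P 0 tau <= Mmax beta tau)%E.
  exact: (@le_bigmax_seq _ _ _ _ -oo%E 0%N xpredT (fun nu => risk P nu tau)).
have Mmax_le beta tau x :
    (forall nu, (nu <= ks beta)%N -> (risk P nu tau <= x)%E) ->
    (Mmax beta tau <= x)%E.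
  move=> le_x; rewrite /Mmax big_nat_cond; apply: bigmax_le => [|nu].
    exact: leNye.
  by rewrite andbT => /andP[_ nuk]; exact: le_x.
have Msup_ge beta tau : (risk P 0 tau <= Msup beta tau)%E.
  by apply: ereal_sup_ubound; exists 0%N.
have Msup_le beta tau x :
    (forall nu, (nu <= ks beta)%N -> (risk P nu tau <= x)%E) ->
    (Msup beta tau <= x)%E.
  by move=> le_x; apply: ge_ereal_sup => _ [nu nuk <-]; exact: le_x.
split=> [nu| |nu|].
- exact: within_factor_ratio (Hrisk nu) (Trisk nu).
- apply: (within_factor_ratio L0).
    exact: (inf_worst_within_factor model ms_ge1 ks_gtm lim_alpha1 lim_alpha3
      I0 dev Mmax_ge Mmax_le).
  exact: (SR_worst_within_factor model ms_ge1 ks_gtm lim_alpha1 lim_alpha3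
    I0 dev Mmax_ge Mmax_le).
- split; first exact: within_factor_ratio (Trisk nu) (Hrisk nu).
  exact: within_factor_ratio (Hrisk nu) LL.
- have Hworst := inf_worst_within_factor model ms_ge1 ks_gtm lim_alpha1
    lim_alpha3 I0 dev Msup_ge Msup_le.
  split; last exact: within_factor_ratio Hworst LL.
  apply: (within_factor_ratio L0) Hworst.
  exact: (SR_worst_within_factor model ms_ge1 ks_gtm lim_alpha1 lim_alpha3
    I0 dev Msup_ge Msup_le).
Unshelve. all: by end_near. Qed.
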